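(* Let $\mathcal{X}\subset\mathbb{R}^n$, let $\mathcal{X}_N$ be an $\varepsilon_0$-net of $\mathcal{X}$, let $\varepsilon>0$, $\gamma>0$, and let $\mathscr{S}$ be a subset of the finite sensor set $\mathscr{M}$ satisfying $$\forall\,\mathbf{x}_i,\mathbf{x}_j\in\mathcal{X}_N:\qquad\Vert\mathbf{g}(\mathbf{x}_i)-\mathbf{g}(\mathbf{x}_j)\Vert_2\geq\varepsilon\ \Rightarrow\ \Vert\mathbf{m}_{\mathscr{S}}(\mathbf{x}_i)-\mathbf{m}_{\mathscr{S}}(\mathbf{x}_j)\Vert_2\geq\gamma.$$ If $\mathbf{m}_{\mathscr{S}}$ and $\mathbf{g}$ are Lipschitz functions on $\mathcal{X}$ with Lipschitz constants $\Vert\mathbf{m}_{\mathscr{S}}\Vert_{\mathrm{lip}}$ and $\Vert\mathbf{g}\Vert_{\mathrm{lip}}$ respectively, then $$\forall\,\mathbf{x},\mathbf{x}'\in\mathcal{X}:\qquad\Vert\mathbf{g}(\mathbf{x})-\mathbf{g}(\mathbf{x}')\Vert_2\geq\varepsilon+2\varepsilon_0\Vert\mathbf{g}\Vert_{\mathrm{lip}}\ \Rightarrow\ \Vert\mathbf{m}_{\mathscr{S}}(\mathbf{x})-\mathbf{m}_{\mathscr{S}}(\mathbf{x}')\Vert_2>\gamma-2\varepsilon_0\Vert\mathbf{m}_{\mathscr{S}}\Vert_{\mathrm{lip}}.$$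
   Context: The target function is $\mathbf{g}:\mathcal{X}\to\mathbb{R}^q$ and the sensors are functions $\mathbf{m}_j:\mathcal{X}\to\mathbb{R}^{d_j}$, $j\in\mathscr{M}$. For $\mathscr{S}=\{j_1,\dots,j_K\}\subseteq\mathscr{M}$, $\mathbf{m}_{\mathscr{S}}(\mathbf{x})=(\mathbf{m}_{j_1}(\mathbf{x}),\dots,\mathbf{m}_{j_K}(\mathbf{x}))$ is the concatenated measurement. An $\varepsilon_0$-net of $\mathcal{X}$ is a finite subset $\mathcal{X}_N\subset\mathcal{X}$ such that for every $\mathbf{x}\in\mathcal{X}$ there is $\mathbf{x}_i\in\mathcal{X}_N$ with $\Vert\mathbf{x}-\mathbf{x}_i\Vert_2<\varepsilon_0$. Lipschitz constants are with respect to Euclidean norms on $\mathcal{X}$ and the target space. *)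

(* Defs.v *)
From mathcomp Require Import all_boot all_order all_algebra.
From mathcomp Require Import all_classical all_reals.

Set Implicit Arguments.
Unset Strict Implicit.
Unset Printing Implicit Defensive.

Import Order.TTheory GRing.Theory Num.Theory.

Local Open Scope classical_set_scope.
Local Open Scope ring_scope.

(* The norm [`|x|] that MathComp-Analysis puts on matrices is the sup norm,
   and its [k.-lipschitz_A f] refers to that norm. *)
Definition norm2 (R : realType) (n : nat) (x : 'rV[R]_n) : R :=
  Num.sqrt (\sum_(i < n) x 0 i ^+ 2).

Definition is_net (R : realType) (n : nat) (X : set 'rV[R]_n) (eps0 : R)
    (XN : set 'rV[R]_n) : Prop :=
  [/\ finite_set XN, XN `<=` X &
      forall x, X x -> exists2 y, XN y & norm2 (x - y) < eps0].

(* Only the restriction of [f] to [X] matters; [L] need not be optimal. *)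
Definition lipschitz_with (R : realType) (n p : nat) (X : set 'rV[R]_n)
    (f : 'rV[R]_n -> 'rV[R]_p) (L : R) : Prop :=
  0 <= L /\
  forall x y, X x -> X y -> norm2 (f x - f y) <= L * norm2 (x - y).

(* The selected sensors are concatenated in the order of [enum S]: the [k]-th
   block is the value of the sensor [enum_val k]. *)
Definition concat_measurement (R : realType) (n : nat) (M : finType)
    (d : M -> nat) (m : forall j : M, 'rV[R]_n -> 'rV[R]_(d j)) (S : {set M})
    (x : 'rV[R]_n) : 'rV[R]_(\sum_(k < #|S|) d (enum_val k)) :=
  \mxrow_(k < #|S|) m (enum_val k) x.

(* Main.v *)
Require Import Defs.
From mathcomp Require Import all_boot all_order all_algebra.
From mathcomp Require Import all_classical all_reals.
From mathcomp Require Import ring lra.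
Import Order.TTheory GRing.Theory Num.Theory.
Local Open Scope classical_set_scope.
Local Open Scope ring_scope.

(** Replace [x] and [x'] by net points [y] and [y'] at distance less than
    [eps0].  A function with Lipschitz constant [L] changes its distances by at
    most [L * (norm2 (x - y) + norm2 (x' - y'))] under such a replacement
    ([lipschitz_dist_perturb], from the triangle inequality).  For [g] this loses
    at most [2 * eps0 * lip_g], so [y] and [y'] are still [eps]-separated by [g],
    hence [gamma]-separated by the measurement; going back from [y], [y'] to
    [x], [x'] loses at most [2 * eps0 * lip_m].

    The strict inequality comes from the strict inequality in the definition of
    a net, but only when [lip_m > 0].  When [lip_m = 0] the measurement is
    constant on [X], so it cannot separate [y] from [y'] by [gamma > 0], and no
    pair [x], [x'] satisfies the assumption on [g]. *)

Lemma norm2_ge0 {R : realType} {n : nat} (u : 'rV[R]_n) : 0 <= norm2 u.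
Proof. exact: sqrtr_ge0. Qed.

Lemma sqr_norm2 {R : realType} {n : nat} (u : 'rV[R]_n) :
  norm2 u ^+ 2 = \sum_(i < n) u 0 i ^+ 2.
Proof. by rewrite sqr_sqrtr// sumr_ge0// => i _; rewrite sqr_ge0. Qed.

Lemma norm2_eq0 {R : realType} {n : nat} {u : 'rV[R]_n} :
  norm2 u = 0 -> u = 0.
Proof.
move=> u0; have := sqr_norm2 u; rewrite u0 expr0n /= => /esym/eqP.
rewrite psumr_eq0; last by move=> i _; rewrite sqr_ge0.
move=> /allP u2; apply/rowP => i; rewrite mxE; apply/eqP.
by rewrite -sqrf_eq0; exact: (u2 i (mem_index_enum i)).
Qed.

Lemma norm2N {R : realType} {n : nat} (u : 'rV[R]_n) : norm2 (- u) = norm2 u.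
Proof.
by rewrite /norm2; congr Num.sqrt; apply: eq_bigr => i _; rewrite mxE sqrrN.
Qed.

Lemma norm2_distC {R : realType} {n : nat} (u v : 'rV[R]_n) :
  norm2 (u - v) = norm2 (v - u).
Proof. by rewrite -norm2N opprB. Qed.

(** Cauchy-Schwarz.  With [a] and [b] the norms of [u] and [v], the squared norm
    of [b u - a v] is [2 a b (a b - <u, v>)]; divide by [2 a b] unless [u] or [v]
    vanishes. *)
Lemma dot_le_norm2M {R : realType} {n : nat} (u v : 'rV[R]_n) :
  \sum_(i < n) u 0 i * v 0 i <= norm2 u * norm2 v.
Proof.
have [u0|u_neq0] := eqVneq (norm2 u) 0.
  rewrite u0 mul0r (norm2_eq0 u0) big1// => i _.
  by rewrite mxE mul0r.
have [v0|v_neq0] := eqVneq (norm2 v) 0.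
  rewrite v0 mulr0 (norm2_eq0 v0) big1// => i _.
  by rewrite mxE mulr0.
have ab_gt0 : 0 < 2 * (norm2 u * norm2 v).
  by rewrite !mulr_gt0// lt0r ?u_neq0 ?v_neq0 norm2_ge0.
rewrite -subr_ge0 -(pmulr_rge0 _ ab_gt0).
have -> : 2 * (norm2 u * norm2 v) *
    (norm2 u * norm2 v - \sum_(i < n) u 0 i * v 0 i) =
    \sum_(i < n) (norm2 v * u 0 i - norm2 u * v 0 i) ^+ 2.
  rewrite [RHS](eq_bigr (fun i => norm2 v ^+ 2 * u 0 i ^+ 2 +
    norm2 u ^+ 2 * v 0 i ^+ 2 - 2 * (norm2 u * norm2 v) * (u 0 i * v 0 i)));
    last by move=> i _; ring.
  by rewrite sumrB big_split /= -!mulr_sumr -!sqr_norm2; ring.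
by rewrite sumr_ge0// => i _; rewrite sqr_ge0.
Qed.

Lemma ler_norm2D {R : realType} {n : nat} (u v : 'rV[R]_n) :
  norm2 (u + v) <= norm2 u + norm2 v.
Proof.
rewrite -ler_sqr ?nnegrE ?addr_ge0 ?norm2_ge0// sqr_norm2.
under eq_bigr => i _ do rewrite mxE sqrrD.
rewrite 2!big_split /= sumrMnl -!sqr_norm2 sqrrD.
by rewrite lerD2r lerD2l lerMn2r dot_le_norm2M.
Qed.

Lemma ler_norm2_dist {R : realType} {n : nat} (w u v : 'rV[R]_n) :
  norm2 (u - v) <= norm2 (u - w) + norm2 (w - v).
Proof. by rewrite -(subrKA w u (- v)) ler_norm2D. Qed.

(** Triangle inequality along [f x], [f y], [f y'], [f x']. *)
Lemma lipschitz_dist_perturb {R : realType} {n p : nat} {X : set 'rV[R]_n}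
    {f : 'rV[R]_n -> 'rV[R]_p} {L : R} {x x' y y' : 'rV[R]_n} :
  lipschitz_with X f L -> X x -> X x' -> X y -> X y' ->
  norm2 (f x - f x') <=
    norm2 (f y - f y') + L * (norm2 (x - y) + norm2 (x' - y')).
Proof.
move=> [_ lip_f] Xx Xx' Xy Xy'.
have := ler_norm2_dist (f y) (f x) (f x').
have := ler_norm2_dist (f y') (f y) (f x').
have := lip_f _ _ Xx Xy; have := lip_f _ _ Xx' Xy'.
by rewrite (norm2_distC (f y') (f x')); lra.
Qed.

Theorem proposition4p5 (R : realType) (n q : nat) (X : set 'rV[R]_n)
    (g : 'rV[R]_n -> 'rV[R]_q)
    (M : finType) (d : M -> nat) (m : forall j : M, 'rV[R]_n -> 'rV[R]_(d j))
    (eps0 eps gamma : R) (XN : set 'rV[R]_n) (S : {set M}) (lip_m lip_g : R)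
    (net_XN : is_net X eps0 XN) (eps_gt0 : 0 < eps) (gamma_gt0 : 0 < gamma)
    (separates : forall xi xj, XN xi -> XN xj ->
       eps <= norm2 (g xi - g xj) ->
       gamma <= norm2 (concat_measurement m S xi - concat_measurement m S xj))
    (lipschitz_m : lipschitz_with X (concat_measurement m S) lip_m)
    (lipschitz_g : lipschitz_with X g lip_g) :
  forall x x', X x -> X x' ->
    eps + 2 * eps0 * lip_g <= norm2 (g x - g x') ->
    gamma - 2 * eps0 * lip_m <
      norm2 (concat_measurement m S x - concat_measurement m S x').
Proof.
move=> x x' Xx Xx' g_sep.
have [_ XN_X net] := net_XN.
have [y XNy xy] := net _ Xx; have [y' XNy' xy'] := net _ Xx'.
have Xy := XN_X _ XNy; have Xy' := XN_X _ XNy'.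
have [lip_g_ge0 _] := lipschitz_g; have [lip_m_ge0 lip_m_le] := lipschitz_m.
have moves : norm2 (x - y) + norm2 (x' - y') < 2 * eps0 by lra.
have y_sep : eps <= norm2 (g y - g y').
  have := lipschitz_dist_perturb lipschitz_g Xx Xx' Xy Xy'.
  have := ler_wpM2l lip_g_ge0 (ltW moves).
  lra.
have m_sep := separates _ _ XNy XNy' y_sep.
have lip_m_gt0 : 0 < lip_m.
  (* a constant measurement contradicts [m_sep] *)
  rewrite lt0r lip_m_ge0 andbT; apply/eqP => lip_m0.
  by have := lip_m_le _ _ Xy Xy'; rewrite lip_m0 mul0r; lra.
have := lipschitz_dist_perturb lipschitz_m Xy Xy' Xx Xx'.
rewrite (norm2_distC y) (norm2_distC y').
move: moves; rewrite -(ltr_pM2l lip_m_gt0).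
lra.
Qed.
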